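(* For the Laguerre polynomials $L_n(x)$ and every natural number $n\ge 1$ we have \[L_{n}(x)=\left|\begin{array}{cccccc} 1-x&-\frac 12&0&\cdots&0&0\\ -1&\frac{3-x}{2}&-\frac 23&\cdots&0&0\\ 0&-1&\frac{5-x}{3}&\cdots&0&0\\ \vdots&\vdots&\vdots&\ddots&\vdots&\vdots\\ 0&0&0&\cdots&\frac{2n-3-x}{n-1}&-\frac{n-1}{n}\\ 0&0&0&\cdots&-1&\frac{2n-1-x}{n}\end{array}\right|,\] where the determinant has size $n$; that is, the matrix is the $n\times n$ tridiagonal matrix with $(i,i)$ entry $\frac{2i-1-x}{i}$ for $1\le i\le n$, all subdiagonal entries equal to $-1$, and $(i,i+1)$ entry equal to $-\frac{i}{i+1}$ for $1\le i\le n-1$.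
   Context: The Laguerre polynomials are defined by $L_0(x)=1$, $L_1(x)=1-x$, and $L_{n+1}(x)=-\frac{n}{n+1}L_{n-1}(x)+\frac{2n+1-x}{n+1}L_n(x)$ for $n\ge 1$. *)

(* Defs.v *)
From mathcomp Require Import all_boot all_order all_algebra.

Set Implicit Arguments.
Unset Strict Implicit.
Unset Printing Implicit Defensive.

Import GRing.Theory Num.Theory.
Local Open Scope ring_scope.

(* The third branch is (n'+1) L_{n'+1} = - n' L_{n'-1} + (2n'+1-X) L_{n'}
   divided by n'+1, with n' = m.+1 >= 1. *)
Fixpoint laguerre (R : numFieldType) (n : nat) : {poly R} :=
  match n with
  | 0 => 1
  | 1 => 1 - 'X
  | ((m.+1) as n').+1 =>
      - (n'%:R / n'.+1%:R) *: laguerre R m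
      + n'.+1%:R^-1 *: ((2 * n' + 1)%N%:R%:P - 'X) * laguerre R n'
  end.

(* Indices of 'I_n start at 0, so the 1-based index of a row is i.+1 and
   2 (i + 1) - 1 = 2 i + 1. *)
Definition laguerre_mx (R : numFieldType) (n : nat) : 'M[{poly R}]_n :=
  \matrix_(i < n, j < n)
    if i == j :> nat then i.+1%:R^-1 *: ((2 * i + 1)%N%:R%:P - 'X)
    else if i == j.+1 :> nat then -1
    else if j == i.+1 :> nat then (- (i.+1%:R / i.+2%:R))%:P
    else 0.

(* Main.v *)
Require Import Defs.
From mathcomp Require Import all_boot all_order all_algebra.

(** A tridiagonal determinant (a continuant) obeys a three-term recurrence in
    its size, with coefficients read off from its last row and column. For the
    matrix at hand these coefficients are exactly those of the recurrence that
    defines the Laguerre polynomials: the product of the two off-diagonal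
    entries is (-1) * (- n/(n+1)), which the recurrence subtracts. Both
    sequences start from 1 (the empty determinant) and 1 - X, so they coincide;
    the general fact is [det_tridiagonal_rec]. *)

Import GRing.Theory.
Local Open Scope ring_scope.

(** The entries come from one function on [nat], so that the leading principal
    submatrices of the matrix are again of the same form, one for each size. *)
Lemma det_tridiagonal_rec (A : comNzRingType) (f : nat -> nat -> A) (n : nat)
    (f_low : forall i j, (j.+1 < i)%N -> f i j = 0)
    (f_up : forall i j, (i.+1 < j)%N -> f i j = 0) :
  \det (\matrix_(i < n.+2, j < n.+2) f i j) =
    f n.+1 n.+1 * \det (\matrix_(i < n.+1, j < n.+1) f i j)
    - f n n.+1 * f n.+1 n * \det (\matrix_(i < n, j < n) f i j).
Proof.
rewrite (expand_det_row _ ord_max) !big_ord_recr /= big1 => [|j _]; last first.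
  by rewrite mxE f_low ?mul0r //= ltnS.
rewrite add0r addrC !mxE /= /cofactor /=; congr (_ * _ + _).
  rewrite addnn -signr_odd odd_double mul1r; congr (\det _).
  by apply/matrixP=> i j; rewrite !mxE !lift_max.
rewrite addSn addnn -signr_odd /= odd_double expr1 mulN1r mulrN.
rewrite [f n _ * _]mulrC -mulrA; congr (- (_ * _)).
(* This minor drops column n and keeps column n+1, whose only nonzero entry
   among the remaining rows is the superdiagonal one in row n. *)
rewrite (expand_det_col _ ord_max) big_ord_recr /= big1 => [|i _]; last first.
  by rewrite !mxE lift_max /= /bump leqnn add1n f_up ?mul0r // !ltnS.
rewrite add0r !mxE lift_max /= /bump leqnn add1n; congr (_ * _).
rewrite /cofactor addnn -signr_odd odd_double mul1r; congr (\det _).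
by apply/matrixP=> i j; rewrite !mxE !lift_max /= /bump !(ltn_geF (ltn_ord j)).
Qed.

Lemma laguerre_rec (R : numFieldType) (n : nat) :
  laguerre R n.+2 =
    - (n.+1%:R / n.+2%:R) *: laguerre R n
    + n.+2%:R^-1 *: ((2 * n.+1 + 1)%N%:R%:P - 'X) * laguerre R n.+1.
Proof. by []. Qed.

Lemma det_laguerre_mx_rec (R : numFieldType) (n : nat) :
  \det (laguerre_mx R n.+2) =
    - (n.+1%:R / n.+2%:R) *: \det (laguerre_mx R n)
    + n.+2%:R^-1 *: ((2 * n.+1 + 1)%N%:R%:P - 'X) * \det (laguerre_mx R n.+1).
Proof.
pose f (i j : nat) : {poly R} :=
  if i == j then i.+1%:R^-1 *: ((2 * i + 1)%N%:R%:P - 'X)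
  else if i == j.+1 then -1
  else if j == i.+1 then (- (i.+1%:R / i.+2%:R))%:P
  else 0.
rewrite [LHS](@det_tridiagonal_rec _ f) => [|i j ltji|i j ltij].
- rewrite addrC /f !eqxx (ltn_eqF (ltnSn n)) (gtn_eqF (ltnSn n)).
  by rewrite (ltn_eqF (leqnSn n.+1)) mulrN1 mulNr opprK mul_polyC.
- rewrite /f (gtn_eqF (ltnW ltji)) (gtn_eqF ltji).
  by rewrite (ltn_eqF (ltnW (leqW ltji))).
- rewrite /f (ltn_eqF (ltnW ltij)) (gtn_eqF ltij).
  by rewrite (ltn_eqF (ltnW (leqW ltij))).
Qed.

Theorem proposition2p9 (R : numFieldType) (n : nat) (hn : (1 <= n)%N) :
  laguerre R n = \det (laguerre_mx R n).
Proof.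
(* The recurrence has order two, so consecutive values are carried together. *)
suff [] : laguerre R n = \det (laguerre_mx R n)
       /\ laguerre R n.+1 = \det (laguerre_mx R n.+1) by [].
elim: n {hn} => [|n [IHn IHSn]].
  by rewrite det_mx00 det_mx11 mxE /= invr1 scale1r.
by split=> //; rewrite laguerre_rec det_laguerre_mx_rec IHn IHSn.
Qed.
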